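(* Let $X$ and $Y$ be real Hilbert spaces, $A\in\mathcal L(X,Y)$, $b\in Y$. Let $P\subset X$ be a cone (not necessarily convex or closed) and let $K\subset X$ be a bounded set containing $0$ with $\operatorname{cone}(K)=P$. Let $K_r=\overline{\operatorname{conv}}(K)$ and $P_r=\operatorname{cone}(K_r)$. For $\varepsilon\ge0$ consider $$(\mathcal P_\varepsilon):\ \inf\Big\{\tfrac12 j_{K_r}^2(x) : x\in X,\ \|Ax-b\|_Y\le\varepsilon\Big\},\qquad (\mathcal D_\varepsilon):\ \inf_{y\in Y}\ \tfrac12\sigma_{K_r}^2(A^*y)-\langle b,y\rangle_Y+\varepsilon\|y\|_Y .$$ Consider the two conditions $$\text{(H)}\ \ \forall y\in Y,\ A^*y\in\operatorname{sing}(K_r)^c\cup P_r^\circ;\qquad \text{(E)}\ \ \operatorname{ext}(K_r)\subset K.$$ (i) If $b\in\overline{A(P_r)}$, then for any $\varepsilon>0$: $(\mathcal P_\varepsilon)$ admits a solution $x_\varepsilon^\star\in P_r$ such that $\|Ax_\varepsilon^\star-b\|_Y\le\varepsilon$; $(\mathcal D_\varepsilon)$ admits a unique solution $y_\varepsilon^\star$; and if (H) and (E) hold, then $x_\varepsilon^\star$ is the unique solution of $(\mathcal P_\varepsilon)$, $x_\varepsilon^\star\in P$, and $\{x_\varepsilon^\star\}=\sigma_{K_r}(A^*y_\varepsilon^\star)\,\partial\sigma_{K_r}(A^*y_\varepsilon^\star)$. (ii) If $b\in A(P_r)$, then $(\mathcal P_0)$ admits a solution $x^\star\in P_r$ such that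 $Ax^\star=b$; if furthermore $(\mathcal D_0)$ admits a solution $y^\star$, and (H) and (E) hold, then $x^\star\in P$ and $\{x^\star\}=\sigma_{K_r}(A^*y^\star)\,\partial\sigma_{K_r}(A^*y^\star)$.
   Context: $\mathcal L(X,Y)$ is the space of bounded linear operators; $A^*\in\mathcal L(Y,X)$ is the Hilbert adjoint. For $C\subset X$ containing $0$, $\operatorname{cone}(C)=\{\lambda c:\lambda\ge0,\ c\in C\}$. $\overline{\operatorname{conv}}(K)$ is the closed convex hull. $\sigma_{K_r}(x)=\sup_{v\in K_r}\langle x,v\rangle_X$ is the support function, $j_{K_r}(x)=\inf\{\alpha>0 : x\in\alpha K_r\}\in[0,+\infty]$ the gauge function, $\partial\sigma_{K_r}(z)=\{v\in K_r:\langle z,v\rangle_X=\sigma_{K_r}(z)\}$ the subdifferential. $\operatorname{sing}(K_r)$ is the set of $z\in X$ such that $\partial\sigma_{K_r}(z)$ is not a singleton, and $\operatorname{sing}(K_r)^c$ its complement in $X$. $P_r^\circ=\{x\in X:\langle x,v\rangle_X\le0\ \forall v\in P_r\}$. $\operatorname{ext}(K_r)$ is the set of extreme points of $K_r$. A solution of an optimisation problem is a minimiser with finite value. *)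

(* Defs.v *)
From HB Require Import structures.
From mathcomp Require Import all_boot all_order all_algebra.
From mathcomp Require Import all_classical all_reals all_analysis.

Set Implicit Arguments.
Unset Strict Implicit.
Unset Printing Implicit Defensive.

Import Order.TTheory GRing.Theory Num.Theory.
Import numFieldNormedType.Exports.

Local Open Scope classical_set_scope.
Local Open Scope ring_scope.

(** Real Hilbert spaces: complete normed modules over [R : realType] whose norm
    is induced by an inner product. *)
HB.mixin Record CompleteNormedModule_isHilbert (R : realType) X
    of CompleteNormedModule R X := {
  inner : {dot X for (@idfun R)} ;
  innerxx : forall x : X, inner x x = `|x| ^+ 2
}.

#[short(type="hilbertType")]
HB.structure Definition Hilbert (R : realType) :=
  {X of CompleteNormedModule R X & CompleteNormedModule_isHilbert R X}.

Notation "'⟨' x , y '⟩'" := (inner x y)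
  (at level 0, x, y at level 99, format "'⟨' x ,  y '⟩'") : ring_scope.

Section HilbertDefs.
Context {R : realType}.
Implicit Types (X Y : hilbertType R).

(** For [A] linear and continuous, the set below is a singleton by the Riesz
    representation theorem; the default value of [xget] is then never used. *)
Definition adjoint X Y (A : X -> Y) (y : Y) : X :=
  xget 0 [set z : X | forall x : X, ⟨A x, y⟩ = ⟨x, z⟩].

Definition is_cone X (C : set X) : Prop :=
  C 0 /\ forall (l : R) (x : X), 0 <= l -> C x -> C (l *: x).

Definition cone X (C : set X) : set X :=
  [set x | exists2 l : R, 0 <= l & exists2 c, C c & x = l *: c].

Definition conv X (C : set X) : set X := smallest (@convex_set R X) C.

Definition closed_conv X (C : set X) : set X := closure (conv C).

(** [sup] is the supremum in [R]: this is the support function of [C] only for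
    [C] nonempty and bounded. *)
Definition support_fun X (C : set X) (x : X) : R := sup [set ⟨x, v⟩ | v in C].

(** [ereal_inf] of the empty set is [+oo]. *)
Definition gauge_fun X (C : set X) (x : X) : \bar R :=
  ereal_inf [set a%:E | a in
    [set a : R | 0 < a /\ exists2 v, C v & x = a *: v]].

Definition subdiff_support X (C : set X) (z : X) : set X :=
  [set v | C v /\ ⟨z, v⟩ = support_fun C z].

Definition sing X (C : set X) : set X :=
  [set z | ~ exists v, subdiff_support C z = [set v]].

Definition polar X (C : set X) : set X :=
  [set x | forall v, C v -> ⟨x, v⟩ <= 0].

Definition ext X (C : set X) : set X :=
  [set v | C v /\ forall (x y : X) (t : R), C x -> C y -> 0 < t < 1 ->
     v = t *: x + (1 - t) *: y -> x = v /\ y = v].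

Definition is_solution (T : Type) (D : set T) (f : T -> \bar R) (x : T) : Prop :=
  [/\ D x, f x \is a fin_num & forall x', D x' -> (f x <= f x')%E].

Definition primal_feasible X Y (A : X -> Y) (b : Y) (eps : R) : set X :=
  [set x | `|A x - b| <= eps].

Definition primal_cost X (C : set X) (x : X) : \bar R :=
  ((2^-1)%:E * gauge_fun C x ^+ 2)%E.

Definition dual_cost X Y (A : X -> Y) (b : Y) (C : set X) (eps : R) (y : Y) : R :=
  2^-1 * support_fun C (adjoint A y) ^+ 2 - ⟨b, y⟩ + eps * `|y|.

Definition primal_solution X Y (A : X -> Y) (b : Y) (C : set X) (eps : R) (x : X) :=
  is_solution (primal_feasible A b eps) (primal_cost C) x.

Definition dual_solution X Y (A : X -> Y) (b : Y) (C : set X) (eps : R) (y : Y) :=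
  is_solution [set: Y] (fun y' => (dual_cost A b C eps y')%:E) y.

Definition hyp_H X Y (A : X -> Y) (C : set X) : Prop :=
  forall y : Y, (~` sing C `|` polar (cone C)) (adjoint A y).

Definition hyp_E X (K C : set X) : Prop := ext C `<=` K.

End HilbertDefs.

(* Main.v *)
Require Import Defs.
From HB Require Import structures.
From mathcomp Require Import all_boot all_order all_algebra.
From mathcomp Require Import all_classical all_reals all_analysis.
From mathcomp Require Import ring lra.

Set Implicit Arguments.
Unset Strict Implicit.
Unset Printing Implicit Defensive.

Import Order.TTheory GRing.Theory Num.Theory.
Import numFieldNormedType.Exports.

Local Open Scope classical_set_scope.
Local Open Scope ring_scope.

(** The proof rests on three facts about Hilbert spaces, all obtained from the
    parallelogram identity.

    Existence. A directed family of nonempty bounded closed convex sets has a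
    common point ([directed_closed_convex_meet]). This replaces weak compactness:
    it yields minimizers of coercive continuous convex functions, hence the Riesz
    representation that makes the adjoint meaningful, the projection of [b] on
    the image of a dilation of [Kr], the dual solution, and the primal solution.
    The sublevel sets of the primal cost are the dilations of [Kr]
    ([primal_cost_le]). The dual cost is coercive for [eps > 0] because [b] lies
    within [eps / 2] of some [A (l *: v)] with [v] in [Kr].

    Uniqueness of the dual solution. The squared support function need not be
    strictly convex, but the norm is strictly convex apart from rays. Two
    distinct minimizers lie on one ray, on which the support function must
    vanish; the choice of [b] in the closure of the image of the cone then
    excludes this ([support_objective_minimum_unique]).

    Link between the problems. Let [y] be a dual solution and [s] the value of
    the support function at [adjoint A y]. The dilation of [Kr] by [s] contains a
    feasible point, for otherwise the residual of the projection of [b] would be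
    a direction of descent at [y] ([strong_duality]). Hence every primal solution
    is [s *: v] with [v] in [Kr], and the stationarity of the dual cost along the
    ray through [y] forces [v] to attain the support function
    ([primal_dual_optimality]). Under the two structural conditions the set of
    such [v] is one extreme point of [Kr], which lies in [K], unless [s = 0];
    this gives uniqueness, membership in the cone, and the recovery formula, for
    [eps > 0] and [eps = 0] alike ([exact_recovery]). *)

(** * Inner products and convex sets *)

Section InnerProduct.
Context {R : realType} {X : hilbertType R}.
Implicit Types x y z : X.

Lemma innerC x y : ⟨x, y⟩ = ⟨y, x⟩.
Proof. by rewrite (hermC inner) expr0 mul1r. Qed.

Lemma innerDl x y z : ⟨x + y, z⟩ = ⟨x, z⟩ + ⟨y, z⟩.
Proof. exact: linearDl. Qed.

Lemma innerDr x y z : ⟨x, y + z⟩ = ⟨x, y⟩ + ⟨x, z⟩.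
Proof. exact: linearDr. Qed.

Lemma innerZl a x y : ⟨a *: x, y⟩ = a * ⟨x, y⟩.
Proof. exact: linearZl_LR. Qed.

Lemma innerZr a x y : ⟨x, a *: y⟩ = a * ⟨x, y⟩.
Proof. by rewrite innerC innerZl innerC. Qed.

Lemma innerBl x y z : ⟨x - y, z⟩ = ⟨x, z⟩ - ⟨y, z⟩.
Proof. exact: linearBl. Qed.

Lemma innerBr x y z : ⟨x, y - z⟩ = ⟨x, y⟩ - ⟨x, z⟩.
Proof. exact: linearBr. Qed.

Lemma inner0l x : ⟨0, x⟩ = 0.
Proof. exact: linear0l. Qed.

Lemma inner0r x : ⟨x, 0⟩ = 0.
Proof. exact: linear0r. Qed.

Lemma sqr_normD x y : `|x + y| ^+ 2 = `|x| ^+ 2 + 2 * ⟨x, y⟩ + `|y| ^+ 2.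
Proof. by rewrite -!innerxx innerDl !innerDr (innerC y x); ring. Qed.

Lemma sqr_normB x y : `|x - y| ^+ 2 = `|x| ^+ 2 - 2 * ⟨x, y⟩ + `|y| ^+ 2.
Proof. by rewrite -!innerxx innerBl !innerBr (innerC y x); ring. Qed.

(** Expanding the square of the vector [`|y| *: x - `|x| *: y] gives
    [2 * `|x| * `|y| * (`|x| * `|y| - ⟨x, y⟩)]. *)
Lemma cauchy_schwarz x y : ⟨x, y⟩ <= `|x| * `|y|.
Proof.
have := sqr_ge0 (`| `|y| *: x - `|x| *: y|).
rewrite sqr_normB innerZl innerZr !normrZ !normr_id.
have := normr_ge0 x; have := normr_ge0 y.
have [->|x0] := eqVneq x 0; first by rewrite inner0l normr0 mul0r.
have [->|y0] := eqVneq y 0; first by rewrite inner0r normr0 mulr0.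
have {x0} x0 : 0 < `|x| by rewrite normr_gt0.
have {y0} y0 : 0 < `|y| by rewrite normr_gt0.
move=> _ _ h; rewrite -(ler_pM2l (mulr_gt0 x0 y0)); nra.
Qed.

Lemma inner_norm_le x y : `|⟨x, y⟩| <= `|x| * `|y|.
Proof.
rewrite ler_norml cauchy_schwarz andbT -lerN2 opprK.
by rewrite -mulN1r -innerZl scaleN1r -(normrN x) cauchy_schwarz.
Qed.

(** Written with the midpoint, which lies in every convex set containing both
    points: two almost shortest vectors of a convex set are close together. *)
Lemma parallelogram x y :
  `|x - y| ^+ 2 = 2 * `|x| ^+ 2 + 2 * `|y| ^+ 2 - 4 * `|2^-1 *: x + 2^-1 *: y| ^+ 2.
Proof.
rewrite -(scalerDr _ x y) normrZ ger0_norm ?invr_ge0// sqr_normB exprMn sqr_normD.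
by field.
Qed.

Lemma inner_continuous y : continuous (fun x : X => ⟨x, y⟩).
Proof.
move=> x; apply/cvgrPdist_le => e e0; near=> z.
rewrite -innerBl (le_trans (inner_norm_le _ _))//.
rewrite (@le_trans _ _ (`|x - z| * (`|y| + 1)))//.
  by rewrite ler_wpM2l// lerDl.
rewrite -ler_pdivlMr ?ltr_wpDl//; near: z.
by apply: cvgr_dist_le; rewrite ?divr_gt0 ?ltr_wpDl.
Unshelve. all: by end_near. Qed.

End InnerProduct.

Section ConvexSets.
Context {R : realType} {X : hilbertType R}.
Implicit Types C : set X.

(** Convexity with a plain real weight, in place of a bundled element of the
    unit interval. *)
Lemma convex_setP C : @convex_set R X C <->
  (forall x y (t : R), C x -> C y -> 0 <= t <= 1 -> C (t *: x + (1 - t) *: y)).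
Proof.
split=> [cC x y t Cx Cy /andP[t0 t1]|cC x y t].
  have t01 : Itv.spec (Itv.num_sem (R:=R)) (Itv.Real `[0%Z, 1%Z]) t.
    by rewrite /Itv.spec/= /Itv.num_sem/= in_itv/= ger0_real//= t0 t1.
  have := cC x y (Itv.mk t01).
  by rewrite !inE => /(_ Cx Cy).
rewrite !inE => Cx Cy; apply: cC => //; apply/andP; split; [exact: ge0|exact: le1].
Qed.

Lemma convex_set_mid C x y : @convex_set R X C -> C x -> C y ->
  C (2^-1 *: x + 2^-1 *: y).
Proof.
move=> /convex_setP cC Cx Cy.
have -> : 2^-1 *: y = (1 - 2^-1 : R) *: y by congr (_ *: _); field.
by apply: cC => //; lra.
Qed.

End ConvexSets.

(** * Weak compactness and minimization *)

Section WeakCompactness.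
Context {R : realType} {X : hilbertType R}.

(** Weak compactness of bounded closed convex sets, without the weak topology.
    The distance [d i] of the origin to [S i] grows along the family and is
    bounded by [M]; let [L] be its supremum. The points of [S i] of norm at most
    [L + a] form a filter base, and by the parallelogram identity these pieces
    have arbitrarily small diameter once [d i] is close to [L]. By completeness
    the filter converges, and its limit belongs to every [S i]. *)
Lemma directed_closed_convex_meet (I : Type) (D : set I) (S : I -> set X) (M : R) :
  (forall i j, D i -> D j -> exists2 k, D k & S k `<=` S i `&` S j) ->
  (forall i, D i -> S i !=set0) ->
  (forall i, D i -> closed (S i)) ->
  (forall i, D i -> @convex_set R X (S i)) ->
  (exists2 i, D i & forall x, S i x -> `|x| <= M) ->
  exists x, forall i, D i -> S i x.
Proof.
move=> dirS S0 clS cvxS [i0 Di0 SM].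
pose d i := inf [set `|x| | x in S i].
have S0' i : D i -> [set `|x| | x in S i] !=set0.
  by move=> /S0[x Sx]; exists `|x|, x.
have lb i : has_lbound [set `|x| | x in S i] by exists 0 => _ [x _ <-].
have d_le i x : S i x -> d i <= `|x| by move=> Sx; apply: ge_inf => //; exists x.
have d_ge0 i : D i -> 0 <= d i.
  by move=> Di; apply: lb_le_inf; [exact: S0'|move=> _ [x _ <-]].
have dM i : D i -> d i <= M.
  move=> Di; have [k Dk sub] := dirS _ _ Di Di0; have [x /sub[Six Si0x]] := S0 _ Dk.
  exact: le_trans (d_le _ _ Six) (SM _ Si0x).
pose L := sup [set d i | i in D].
have supd : has_sup [set d i | i in D].
  by split; [exists (d i0), i0|exists M => _ [i Di <-]; exact: dM].
have dL i : D i -> d i <= L.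
  by move=> Di; apply: ub_le_sup; [exact: supd.2|exists i].
have L0 : 0 <= L := le_trans (d_ge0 _ Di0) (dL _ Di0).
pose G := [set p : I * R | D p.1 /\ 0 < p.2].
pose B (p : I * R) := S p.1 `&` [set x | `|x| <= L + p.2].
have FF : Filter (filter_from G B).
  apply: filter_from_filter; first by exists (i0, 1).
  move=> [i a] [j c] [/= Di a0] [/= Dj c0].
  have [k Dk sub] := dirS _ _ Di Dj.
  exists (k, Num.min a c); first by split=> //=; rewrite lt_min a0 c0.
  move=> x [/= /sub[Six Sjx]]; rewrite minElt => xac; split; split=> //=;
    by apply: le_trans xac _; case: ltP => //; lra.
have PF : ProperFilter (filter_from G B).
  apply: filter_from_proper => -[i a] [/= Di a0].
  have [_ [x Sx <-] xlt] := inf_adherent a0 (conj (S0' _ Di) (lb i)).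
  by exists x; split=> //=; rewrite ltW// (lt_le_trans xlt)// lerD2r dL.
have : cvg (filter_from G B).
  apply: cauchy_cvg; apply: cauchy_exP => e e0.
  pose dl := Num.min 1 (e ^+ 2 / (16 * L + 8)).
  have L8 : 0 < 16 * L + 8 by lra.
  have e2 : 0 < e ^+ 2 by rewrite exprn_gt0.
  have dl0 : 0 < dl by rewrite lt_min ltr01 divr_gt0.
  have dl1 : dl <= 1 by rewrite ge_min lexx.
  have dle : dl * (16 * L + 8) <= e ^+ 2.
    by rewrite -ler_pdivlMr// ge_min lexx orbT.
  have [_ [i Di <-] Ldi] := sup_adherent dl0 supd.
  have [_ [x Sx <-] xlt] := inf_adherent dl0 (conj (S0' _ Di) (lb i)).
  have xL : `|x| <= L + dl by rewrite ltW// (lt_le_trans xlt)// lerD2r dL.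
  exists x; exists (i, dl) => // y [/= Sy yL].
  rewrite -ball_normE/=.
  have := d_le _ _ (convex_set_mid (cvxS _ Di) Sx Sy).
  have := parallelogram x y.
  move: (2^-1 *: x + _) => m par dm.
  (* The bound (L - dl)^2 is valid only when dl <= L; the smaller one used here
     holds in all cases. *)
  have m2 : L ^+ 2 - 2 * L * dl <= `|m| ^+ 2.
    have [Ldl|Ldl] := leP dl L.
      apply: (@le_trans _ _ ((L - dl) ^+ 2)).
        by have := sqr_ge0 dl; nra.
      by rewrite ler_sqr ?nnegrE ?subr_ge0// (le_trans _ dm)// ltW.
    by have := sqr_ge0 `|m|; nra.
  have x2 : `|x| ^+ 2 <= (L + dl) ^+ 2 by rewrite ler_sqr ?nnegrE ?addr_ge0// ltW.
  have y2 : `|y| ^+ 2 <= (L + dl) ^+ 2 by rewrite ler_sqr ?nnegrE ?addr_ge0// ltW.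
  rewrite -ltr_sqr ?nnegrE ?(ltW e0)//.
  rewrite par; nra.
move=> /cvg_ex[x Fx]; exists x => i Di; apply: clS => // V /Fx FV.
apply: (@filter_ex _ (filter_from G B)); apply: filterI FV; exists (i, 1) => //.
by move=> y [].
Qed.

End WeakCompactness.

Section ConvexMinimization.
Context {R : realType} {X : hilbertType R}.

(** The nonempty sublevel sets of [g] on [C] are nested, closed, convex and
    bounded; a common point is a minimizer. *)
Lemma convex_minimum_attained (C : set X) (g : X -> R) :
  C !=set0 -> closed C -> @convex_set R X C ->
  continuous g ->
  (forall x y (t : R), 0 <= t <= 1 ->
     g (t *: x + (1 - t) *: y) <= t * g x + (1 - t) * g y) ->
  (forall t : R, exists M, forall x, C x -> g x <= t -> `|x| <= M) ->
  exists2 x, C x & forall x', C x' -> g x <= g x'.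
Proof.
move=> [c Cc] clC /convex_setP cvxC ctg cvxg bdg.
pose S t := C `&` [set x | g x <= t].
have [M SM] := bdg (g c).
have [|||||x Sx] := @directed_closed_convex_meet _ _ _ [set t | S t !=set0] S M.
- move=> s t Ss St; have [st|/ltW ts] := leP s t.
    by exists s => // x [Cx /= xs]; split=> //; split=> //=; exact: le_trans st.
  by exists t => // x [Cx /= xt]; split=> //; split=> //=; exact: le_trans ts.
- by [].
- by move=> t _; apply: closedI => //; exact: (closed_comp _ (@closed_le _ t)).
- move=> t _; apply/convex_setP => x y s [Cx /= gx] [Cy /= gy] s01.
  split; [exact: cvxC|apply: le_trans (cvxg _ _ _ s01) _].
  by case/andP: s01 => s0 s1; nra.
- by exists (g c); [exists c; split=> /=|move=> x [Cx gx]; exact: SM].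
have [Cx _] : S (g c) x by apply: Sx; exists c; split=> /=.
exists x => // x' Cx'.
by have [] : S (g x') x by apply: Sx; exists x'; split=> /=.
Qed.

(** First-order optimality: every variational inequality below comes from
    perturbing a minimizer by a small step [s] and reading off the linear term. *)
Lemma quadratic_slope_ge0 (a c : R) :
  (forall s, 0 < s <= 1 -> 0 <= s * c + s ^+ 2 * a) -> 0 <= c.
Proof.
move=> h; rewrite leNgt; apply/negP => c0.
have a1 : 0 < `|a| + 1 by rewrite ltr_wpDl.
have ca : 0 < - c / (2 * (`|a| + 1)) by rewrite divr_gt0 ?mulr_gt0// oppr_gt0.
pose s := Num.min 1 (- c / (2 * (`|a| + 1))).
have s0 : 0 < s by rewrite lt_min ltr01 ca.
have sa : s * (2 * (`|a| + 1)) <= - c.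
  by rewrite -ler_pdivlMr ?mulr_gt0// ge_min lexx orbT.
have := h s; rewrite s0 ge_min lexx => /(_ isT).
have := ler_norm a; nra.
Qed.

(** A minimizer [z] of [2^-1 * `|x| ^+ 2 - f x] represents [f]: the derivative of
    this function at [z] is [⟨_, z⟩ - f]. *)
Lemma riesz_representation (f : X -> R^o) (M : R) :
  linear f -> (forall x, `|f x| <= M * `|x|) -> exists z, forall x, f x = ⟨x, z⟩.
Proof.
move=> linf fM.
have fDZ a x y : f (a *: x + y) = a * f x + f y by exact: linf.
pose lf := GRing.isLinear.Build _ _ _ _ f linf.
pose F : {linear X -> R^o} := HB.pack f lf.
have fc : continuous f.
  apply: (@bounded_linear_continuous _ _ _ F); apply/linear_boundedP.
  exists M; split; first exact: num_real.
  by move=> r Mr x; rewrite (le_trans (fM _))// ler_wpM2r// ltW.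
pose g x := 2^-1 * `|x| ^+ 2 - f x.
have [||||||z _ zmin] := @convex_minimum_attained [set: X] g.
- by exists 0.
- exact: closedT.
- by apply/convex_setP.
- move=> x; apply: cvgB; last exact: fc.
  by apply: cvgMr; rewrite expr2; under eq_fun do rewrite expr2; apply: cvgM; exact: cvg_norm.
- move=> x y t /andP[t0 t1]; rewrite /g fDZ -[(1 - t) *: y]addr0 fDZ.
  have -> : f 0 = 0 by have := fDZ (-1) 0 0; rewrite scaler0 addr0 mulN1r; lra.
  have t1' : 0 <= 1 - t by rewrite subr_ge0.
  rewrite !addr0 sqr_normD !normrZ !exprMn innerZl innerZr (ger0_norm t0) (ger0_norm t1').
  have := mulr_ge0 (mulr_ge0 t0 t1') (sqr_ge0 `|x - y|); rewrite sqr_normB.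
  lra.
- move=> t; exists (2 * `|M| + 2 * `|t| + 1) => x _; rewrite /g => gx.
  have := fM x; have := ler_norm (f x).
  have := ler_norm M; have := ler_norm t.
  have := normr_ge0 M; have := normr_ge0 t.
  rewrite leNgt => *; apply/negP => xb.
  nra.
exists z => x; apply/eqP; rewrite -subr_eq0; apply/eqP.
have zmin' s : 0 <= s * (f x - ⟨x, z⟩) + s ^+ 2 * (`|x| ^+ 2 / 2).
  have := zmin (- s *: x + z) I; rewrite /g fDZ sqr_normD normrZ exprMn
    real_normK ?num_real// innerZl sqrrN.
  lra.
apply/eqP; rewrite eq_le -oppr_ge0; apply/andP; split.
  apply: (@quadratic_slope_ge0 (`|x| ^+ 2 / 2)) => s _.
  by have := zmin' (- s); rewrite sqrrN mulrN mulNr.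
by apply: (@quadratic_slope_ge0 (`|x| ^+ 2 / 2)) => s _; exact: zmin'.
Qed.
End ConvexMinimization.

(** * Adjoint, support function and gauge *)

Section Adjoint.
Context {R : realType} {X Y : hilbertType R}.
Context (A : {linear X -> Y}) (hA : continuous A).

Lemma continuous_linear_norm_le : exists2 M, 0 <= M & forall x, `|A x| <= M * `|x|.
Proof.
have /linear_bounded_continuous/linear_boundedP[M [_ hM]] := hA.
exists (`|M| + 1); first by rewrite addr_ge0.
by apply: hM; rewrite (le_lt_trans (ler_norm M))// ltrDl.
Qed.

Lemma adjointP x y : ⟨A x, y⟩ = ⟨x, adjoint A y⟩.
Proof.
have [M _ AM] := continuous_linear_norm_le.
have [|u|z zP] := @riesz_representation R X (fun x => ⟨A x, y⟩) (M * `|y|).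
- by move=> a u v; rewrite linearP innerDl innerZl.
- by rewrite (le_trans (inner_norm_le _ _))// mulrAC ler_wpM2r.
rewrite /adjoint; case: xgetP => [w _ ->//|/(_ z)[]]; exact: zP.
Qed.

End Adjoint.

Section SupportFunction.
Context {R : realType} {X : hilbertType R}.
Context (C : set X) (bC : bounded_set C) (C0 : C 0).

Lemma bounded_set_norm_le : exists2 M, 0 <= M & forall v, C v -> `|v| <= M.
Proof.
have [M [_ hM]] := bC; exists (`|M| + 1); first by rewrite addr_ge0.
by apply: hM; rewrite (le_lt_trans (ler_norm M))// ltrDl.
Qed.

Lemma le_support_fun x v : C v -> ⟨x, v⟩ <= support_fun C x.
Proof.
have [M M0 CM] := bounded_set_norm_le => Cv.
apply: ub_le_sup; last by exists v.
exists (`|x| * M) => _ [u Cu <-].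
by rewrite (le_trans (cauchy_schwarz _ _))// ler_wpM2l// CM.
Qed.

Lemma support_fun_le x B : (forall v, C v -> ⟨x, v⟩ <= B) -> support_fun C x <= B.
Proof.
by move=> h; apply: ge_sup; [exists ⟨x, 0⟩, 0|move=> _ [v Cv <-]; exact: h].
Qed.

Lemma support_fun_ge0 x : 0 <= support_fun C x.
Proof. by rewrite -(inner0r x) le_support_fun. Qed.

Lemma support_funD x y : support_fun C (x + y) <= support_fun C x + support_fun C y.
Proof.
by apply: support_fun_le => v Cv; rewrite innerDl lerD// le_support_fun.
Qed.

Lemma support_funZ t x : 0 <= t -> support_fun C (t *: x) <= t * support_fun C x.
Proof.
move=> t0; apply: support_fun_le => v Cv.
by rewrite innerZl ler_wpM2l// le_support_fun.
Qed.

Lemma support_fun_continuous : continuous (support_fun C).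
Proof.
have [M M0 CM] := bounded_set_norm_le.
have lip x y : support_fun C x - support_fun C y <= M * `|x - y|.
  rewrite lerBlDl -[x in support_fun C x](subrK y) addrC (le_trans (support_funD _ _))//.
  rewrite lerD2l; apply: support_fun_le => v Cv.
  by rewrite (le_trans (cauchy_schwarz _ _))// mulrC ler_wpM2r// CM.
move=> x; apply/cvgrPdist_le => e e0; near=> y.
have : (M + 1) * `|x - y| <= e.
  rewrite mulrC -ler_pdivlMr ?ltr_wpDl//; near: y.
  by apply: cvgr_dist_le; rewrite ?divr_gt0 ?ltr_wpDl.
have := normr_ge0 (x - y); have := lip x y; have := lip y x.
by rewrite (distrC y x) ler_norml; move=> *; apply/andP; split; lra.
Unshelve. all: by end_near. Qed.

End SupportFunction.

Section ClosedConvexHull.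
Context {R : realType} {X : hilbertType R}.
Implicit Types C : set X.

Lemma closure_normP C x :
  closure C x <-> forall e, 0 < e -> exists2 c, C c & `|x - c| <= e.
Proof.
split=> [clx e e0|h B].
  have [c [Cc xc]] := clx _ (nbhsx_ballx x e e0).
  by exists c => //; move: xc; rewrite -ball_normE/= => /ltW.
move=> /nbhs_ballP[e /= e0 eB]; have [|c Cc xc] := h (e / 2); first by rewrite divr_gt0.
exists c; split=> //; apply: eB; rewrite -ball_normE/= (le_lt_trans xc)//; lra.
Qed.

Lemma convex_set_closure C : @convex_set R X C -> @convex_set R X (closure C).
Proof.
move=> /convex_setP cC; apply/convex_setP => x y t /closure_normP cx /closure_normP cy t01.
apply/closure_normP => e e0.
have [c Cc xc] := cx _ e0; have [d Cd yd] := cy _ e0.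
exists (t *: c + (1 - t) *: d); first exact: cC.
case/andP: t01 => t0 t1; have t1' : 0 <= 1 - t by rewrite subr_ge0.
rewrite opprD addrACA -!scalerBr (le_trans (ler_normD _ _))// !normrZ.
rewrite (ger0_norm t0) (ger0_norm t1'); nra.
Qed.

Lemma sub_closed_conv C : C `<=` closed_conv C.
Proof. by move=> x Cx; apply: subset_closure => M [_]; exact. Qed.

Lemma closed_closed_conv C : closed (closed_conv C).
Proof. exact: closed_closure. Qed.

Lemma convex_closed_conv C : @convex_set R X (closed_conv C).
Proof.
apply: convex_set_closure; apply/convex_setP => x y t Cx Cy t01 M [cM CM].
by move/convex_setP: (cM); apply => //; [apply: Cx|apply: Cy].
Qed.

Lemma bounded_closed_conv C : bounded_set C -> bounded_set (closed_conv C).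
Proof.
move=> /bounded_set_norm_le[M M0 CM]; exists M; split; first exact: num_real.
move=> r Mr x /closure_normP /(_ (r - M)) [|c cc xc]; first by rewrite subr_gt0.
have cM : `|c| <= M.
  have := cc [set x | `|x| <= M]; apply; split=> //.
  apply/convex_setP => u v t /= u1 v1 /andP[t0 t1].
  have t1' : 0 <= 1 - t by rewrite subr_ge0.
  rewrite (le_trans (ler_normD _ _))// !normrZ (ger0_norm t0) (ger0_norm t1'); nra.
by have := ler_normD (x - c) c; rewrite subrK /=; lra.
Qed.

End ClosedConvexHull.

Section Gauge.
Context {R : realType} {X : hilbertType R}.
Context (C : set X) (bC : bounded_set C) (C0 : C 0).
Context (clC : closed C) (cvxC : @convex_set R X C).

Lemma scale_convex_sub s v : 0 <= s <= 1 -> C v -> C (s *: v).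
Proof.
move=> s01 Cv; move/convex_setP: cvxC => /(_ v 0 s Cv C0 s01).
by rewrite scaler0 addr0.
Qed.

Lemma closed_scaled s : closed [set s *: v | v in C].
Proof.
have [->|s0] := eqVneq s 0.
  rewrite (_ : [set _ | _ in _] = [set 0]); first exact:
    accessible_closed_set1 (hausdorff_accessible (@norm_hausdorff _ X)) 0.
  apply/seteqP; split=> [_ [v _ <-]|_ ->]; rewrite /= ?scale0r//.
  by exists 0 => //; rewrite scale0r.
rewrite (_ : [set _ | _ in _] = (fun x => s^-1 *: x) @^-1` C).
  by apply: closed_comp => // x _; exact: scaler_continuous.
apply/seteqP; split=> [_ [v Cv <-]|x Cx] /=; first by rewrite scalerA mulVf// scale1r.
by exists (s^-1 *: x) => //; rewrite scalerA mulfV// scale1r.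
Qed.

Lemma convex_scaled s : @convex_set R X [set s *: v | v in C].
Proof.
apply/convex_setP => _ _ t [u Cu <-] [v Cv <-] t01.
exists (t *: u + (1 - t) *: v); first by move/convex_setP: cvxC; apply.
by rewrite scalerDr !scalerA (mulrC s) (mulrC s).
Qed.

Lemma gauge_fun_ge0 x : (0 <= gauge_fun C x)%E.
Proof. by apply: le_ereal_inf_tmp => _ [a [a0 _] <-]; rewrite lee_fin ltW. Qed.

(** A point [x] of finite gauge lies in the dilation of [C] by this gauge, being a
    limit of points of this closed dilation. For [s = 0] it is the boundedness of
    [C] that forces [x = 0]. *)
Lemma gauge_fun_le x s : 0 <= s ->
  (gauge_fun C x <= s%:E)%E <-> [set s *: v | v in C] x.
Proof.
move=> s0; split=> [gs|[v Cv <-]].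
  apply: closed_scaled => //; apply/closure_normP => e e0.
  have [M M0 CM] := bounded_set_norm_le bC.
  pose d := e / (M + 1).
  have d0 : 0 < d by rewrite divr_gt0// ltr_wpDl.
  have [_ [a [a0 [v Cv xE]] <-]] : exists2 y, [set a%:E | a in
    [set a : R | 0 < a /\ exists2 v, C v & x = a *: v]] y & (y < (s + d)%:E)%E.
    by apply: ereal_inf_lt; rewrite (le_lt_trans gs)// lte_fin ltrDl.
  rewrite lte_fin => asd.
  have [as_|sa] := leP a s.
    have s1 : 0 < s by exact: lt_le_trans as_.
    exists x; last by rewrite subrr normr0 ltW.
    exists ((a / s) *: v); last by rewrite scalerA mulrCA mulfV ?gt_eqF// mulr1.
    apply: scale_convex_sub => //; rewrite divr_ge0 ?(ltW a0)//=.
    by rewrite ler_pdivrMr// mul1r.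
  exists (s *: v); first by exists v.
  rewrite xE -scalerBl normrZ ger0_norm ?subr_ge0 ?(ltW sa)//.
  have de : d * (M + 1) = e by rewrite /d divfK// gt_eqF// ltr_wpDl.
  have := CM _ Cv; have := normr_ge0 v; nra.
apply/lee_addgt0Pr => e e0; rewrite -EFinD.
have se : 0 < s + e by rewrite ltr_wpDl.
apply: ereal_inf_lbound; exists (s + e) => //; split=> //.
exists ((s / (s + e)) *: v); last by rewrite scalerA mulrCA mulfV ?gt_eqF// mulr1.
apply: scale_convex_sub => //; rewrite divr_ge0 ?(ltW se)//=.
by rewrite ler_pdivrMr// mul1r lerDl ltW.
Qed.

(** All uses of the primal cost go through this description of its sublevel
    sets as the dilations of [C]. *)
Lemma primal_cost_le x s : 0 <= s ->
  (primal_cost C x <= (2^-1 * s ^+ 2)%:E)%E <-> [set s *: v | v in C] x.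
Proof.
move=> s0; rewrite -gauge_fun_le// /primal_cost.
have := gauge_fun_ge0 x; case: (gauge_fun C x) => [r||]//=.
- rewrite -!EFinM !lee_fin => r0.
  by rewrite ler_pM2l ?invr_gt0// -expr2 ler_sqr.
- by rewrite mulyy gt0_muley ?lte_fin ?invr_gt0// !leye_eq.
Qed.

Lemma primal_cost_sqr x : primal_cost C x \is a fin_num ->
  exists2 s, 0 <= s & primal_cost C x = (2^-1 * s ^+ 2)%:E.
Proof.
rewrite /primal_cost; have := gauge_fun_ge0 x; case: (gauge_fun C x) => [r||]//=.
- by rewrite lee_fin => r0 _; exists r.
- by rewrite mulyy gt0_muley ?lte_fin ?invr_gt0.
Qed.

End Gauge.

(** * The dual problem *)

Section SupportRegularization.
Context {R : realType} {Y : hilbertType R}.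
Context (C : set Y) (b : Y) (eps : R) (bC : bounded_set C) (C0 : C 0).

(** The dual cost, once the support function of a set composed with the adjoint
    is seen as the support function of the image of that set. *)
Definition support_objective (y : Y) : R :=
  2^-1 * support_fun C y ^+ 2 - ⟨b, y⟩ + eps * `|y|.

Let sigma := support_fun C.
Let sD := support_funD bC C0.
Let sZ := support_funZ bC C0.
Let s0 := support_fun_ge0 bC C0.

(** The defect term makes the values of [sigma] agree at any two minimizers. *)
Lemma sqr_support_convex x y (t : R) : 0 <= t <= 1 ->
  sigma (t *: x + (1 - t) *: y) ^+ 2 <=
    t * sigma x ^+ 2 + (1 - t) * sigma y ^+ 2 - t * (1 - t) * (sigma x - sigma y) ^+ 2.
Proof.
case/andP=> t0 t1; have t1' : 0 <= 1 - t by rewrite subr_ge0.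
have le1 : sigma (t *: x + (1 - t) *: y) <= t * sigma x + (1 - t) * sigma y.
  by rewrite (le_trans (sD _ _))// lerD// sZ.
have := s0 (t *: x + (1 - t) *: y); move: le1; rewrite -/sigma.
move: (sigma (_ + _)) => u; move: (sigma x) (sigma y) => p q uM u0.
apply: (@le_trans _ _ ((t * p + (1 - t) * q) ^+ 2)).
  by rewrite ler_sqr ?nnegrE// (le_trans u0).
by rewrite le_eqVlt; apply/orP; left; apply/eqP; ring.
Qed.

(** The bound [b_le] quantifies that [b] is nearly in the cone generated by [C];
    it gives coercivity, since then the objective at [y] is at least
    [(eps - dl) * `|y| - 2^-1 * lam ^+ 2]. *)
Section Minimizer.
Context (lam dl : R) (dl0 : 0 <= dl) (dleps : dl < eps).
Context (b_le : forall y, ⟨b, y⟩ <= lam * sigma y + dl * `|y|).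

Let eps0 : 0 < eps := le_lt_trans dl0 dleps.

Lemma support_objective_minimum :
  exists y, forall y', support_objective y <= support_objective y'.
Proof.
have [||||||y _ ymin] := @convex_minimum_attained _ _ [set: Y] support_objective.
- by exists 0.
- exact: closedT.
- by apply/convex_setP.
- move=> y; apply: cvgD; last by apply: cvgMr; exact: cvg_norm.
  apply: cvgB; last first.
    suff -> : inner b = inner^~ b :> (Y -> R) by exact: inner_continuous.
    by apply/funext => u; rewrite innerC.
  apply: cvgMr; rewrite expr2; under eq_fun do rewrite expr2.
  by apply: cvgM; exact: support_fun_continuous.
- move=> x y t t01; rewrite /support_objective -/sigma.
  have := sqr_support_convex x y t01.
  case/andP: t01 => t0 t1; have t1' : 0 <= 1 - t by rewrite subr_ge0.
  have : `|t *: x + (1 - t) *: y| <= t * `|x| + (1 - t) * `|y|.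
    by rewrite (le_trans (ler_normD _ _))// !normrZ (ger0_norm t0) (ger0_norm t1').
  move=> /(ler_wpM2l (ltW eps0)); rewrite innerDr !innerZr.
  have := mulr_ge0 (mulr_ge0 t0 t1') (sqr_ge0 (sigma x - sigma y)); lra.
- move=> t; exists ((t + 2^-1 * lam ^+ 2) / (eps - dl)) => y _.
  rewrite /support_objective -/sigma ler_pdivlMr ?subr_gt0// => gt.
  have := b_le y; have := sqr_ge0 (sigma y - lam); lra.
by exists y => y'; exact: ymin.
Qed.

(** At the midpoint of two minimizers both convexity inequalities are equalities.
    Equality in the triangle inequality puts the minimizers on a common ray, and
    [sigma] takes the same value at both. If they differ, [sigma], being
    homogeneous, vanishes on the ray; the objective is then linear and constant
    there, so that [⟨b, z⟩ = eps * `|z|], which contradicts [b_le]. *)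
Lemma support_objective_minimum_unique y z :
  (forall y', support_objective y <= support_objective y') ->
  (forall y', support_objective z <= support_objective y') -> y = z.
Proof.
wlog yz : y z / `|y| <= `|z|.
  move=> H ymin zmin; have [yz|/ltW zy] := leP `|y| `|z|; first exact: H.
  by rewrite (H z y).
move=> ymin zmin.
have yzm : support_objective y = support_objective z.
  by apply/eqP; rewrite eq_le ymin zmin.
have := ymin (2^-1 *: y + (1 - 2^-1) *: z); move: (yzm).
have := @sqr_support_convex y z 2^-1 ltac:(lra).
have : `|2^-1 *: y + (1 - 2^-1) *: z| <= 2^-1 * (`|y| + `|z|).
  rewrite (le_trans (ler_normD _ _))// !normrZ !ger0_norm ?invr_ge0//; lra.
have : `|2^-1 *: y + (1 - 2^-1) *: z| ^+ 2 =
    4^-1 * (`|y| ^+ 2 + 2 * ⟨y, z⟩ + `|z| ^+ 2).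
  rewrite sqr_normD !normrZ !ger0_norm ?invr_ge0//; last by lra.
  by rewrite innerZl innerZr; field.
rewrite /support_objective -/sigma innerDr !innerZr.
move: (2^-1 *: y + _) => m msq mle sm yzm' mmin.
have sd2 := sqr_ge0 (sigma y - sigma z).
have mE : `|m| = 2^-1 * (`|y| + `|z|).
  apply/eqP; rewrite eq_le mle/= -(ler_pM2l eps0); lra.
have syz : sigma y = sigma z.
  apply/eqP; rewrite -subr_eq0 -sqrf_eq0 eq_le sd2 andbT.
  have := ler_wpM2l (ltW eps0) mle; lra.
have yzn : ⟨y, z⟩ = `|y| * `|z| by move: msq; rewrite mE; lra.
have [z0|z0] := eqVneq `|z| 0.
  move: yz; rewrite z0 normr_le0 => /eqP ->.
  by apply/esym/eqP; rewrite -normr_eq0 z0.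
have {z0} z0 : 0 < `|z| by rewrite lt_neqAle eq_sym z0 normr_ge0.
pose r := `|y| / `|z|.
have yr : `|y| = r * `|z| by rewrite /r divfK ?gt_eqF.
have r0 : 0 <= r by rewrite divr_ge0.
have r1 : r <= 1 by rewrite ler_pdivrMr// mul1r.
have yE : y = r *: z.
  apply/eqP; rewrite -subr_eq0 -normr_eq0 -sqrf_eq0 sqr_normB innerZr yzn normrZ.
  by rewrite (ger0_norm r0) yr; apply/eqP; ring.
move: r1; rewrite le_eqVlt => /predU1P[r1|r1]; first by rewrite yE r1 scale1r.
have sz : sigma z = 0.
  have := sZ z r0; rewrite -yE -/sigma syz => szr.
  have := s0 z; rewrite -/sigma => sz0; nra.
exfalso; move: yzm'; rewrite syz sz yE innerZr normrZ (ger0_norm r0) => yzm'.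
have bz : ⟨b, z⟩ = eps * `|z|.
  have : (1 - r) * (⟨b, z⟩ - eps * `|z|) = 0 by lra.
  by move/eqP; rewrite mulf_eq0 subr_eq0 (gt_eqF r1)/= subr_eq0 => /eqP.
by have := b_le z; rewrite sz mulr0 add0r bz ler_pM2r// leNgt dleps.
Qed.
End Minimizer.

(** The derivative of the objective at [y] in the direction [w] is at most
    [sigma y * sigma w - ⟨b, w⟩ + eps * `|w|], and it is nonnegative. *)
Lemma support_objective_min_slope y w :
  (forall y', support_objective y <= support_objective y') -> 0 <= eps ->
  ⟨b, w⟩ <= sigma y * sigma w + eps * `|w|.
Proof.
move=> ymin eps0; rewrite -subr_ge0.
apply: (@quadratic_slope_ge0 _ (2^-1 * sigma w ^+ 2)) => t /andP[t0 t1].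
have := ymin (y + t *: w); rewrite /support_objective -/sigma innerDr innerZr.
have : `|y + t *: w| <= `|y| + t * `|w|.
  by rewrite (le_trans (ler_normD _ _))// normrZ gtr0_norm.
move=> /(ler_wpM2l eps0).
have : sigma (y + t *: w) ^+ 2 <= (sigma y + t * sigma w) ^+ 2.
  rewrite ler_sqr ?nnegrE ?s0 ?addr_ge0 ?mulr_ge0 ?s0 ?(ltW t0)//.
  by rewrite (le_trans (sD _ _))// lerD2l sZ// ltW.
lra.
Qed.

(** Homogeneity: the perturbation is the shrinking of [y] towards the origin. *)
Lemma support_objective_min_euler y :
  (forall y', support_objective y <= support_objective y') ->
  sigma y ^+ 2 <= ⟨b, y⟩ - eps * `|y|.
Proof.
move=> ymin; rewrite -subr_ge0.
apply: (@quadratic_slope_ge0 _ (2^-1 * sigma y ^+ 2)) => t /andP[t0 t1].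
have t1' : 0 <= 1 - t by rewrite subr_ge0.
have := ymin ((1 - t) *: y); rewrite /support_objective -/sigma innerZr normrZ (ger0_norm t1').
have : sigma ((1 - t) *: y) ^+ 2 <= ((1 - t) * sigma y) ^+ 2.
  by rewrite ler_sqr ?nnegrE ?s0 ?mulr_ge0 ?s0// sZ.
lra.
Qed.

End SupportRegularization.

(** * Duality between the two problems *)

Section PrimalDual.
Context {R : realType} {X Y : hilbertType R}.
Context (A : {linear X -> Y}) (b : Y) (C : set X).
Context (hA : continuous A) (bC : bounded_set C) (C0 : C 0).
Context (clC : closed C) (cvxC : @convex_set R X C).

Lemma bounded_image : bounded_set (A @` C).
Proof.
have [M M0 AM] := continuous_linear_norm_le hA; have [N N0 CN] := bounded_set_norm_le bC.
exists (M * N); split; first exact: num_real.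
move=> r /ltW MNr _ [v Cv <-]; apply: le_trans MNr.
by rewrite (le_trans (AM _))// ler_wpM2l// CN.
Qed.

Lemma image0 : (A @` C) 0.
Proof. by exists 0 => //; rewrite linear0. Qed.

Lemma support_fun_adjoint y : support_fun C (adjoint A y) = support_fun (A @` C) y.
Proof.
congr sup; apply/seteqP; split=> [_ [v Cv <-]|_ [_ [v Cv <-] <-]].
  by exists (A v); [exists v|rewrite innerC adjointP// innerC].
by exists v => //; rewrite innerC -adjointP// innerC.
Qed.

Lemma dual_costE eps y : dual_cost A b C eps y = support_objective (A @` C) b eps y.
Proof. by rewrite /dual_cost support_fun_adjoint. Qed.

Lemma dual_solutionP eps y : dual_solution A b C eps y <->
  forall y', support_objective (A @` C) b eps y <= support_objective (A @` C) b eps y'.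
Proof.
split=> [[_ _ h] y'|h]; first by have := h y' I; rewrite lee_fin !dual_costE.
by split=> // y' _; rewrite lee_fin !dual_costE.
Qed.

(** The points feasible for the constraint and lying in the dilation of [C] by
    [s] decrease with [s]; a common point has the least possible gauge. *)
Lemma primal_solution_exists eps x0 : cone C x0 -> `|A x0 - b| <= eps ->
  exists x, primal_solution A b C eps x /\ cone C x.
Proof.
move=> [l l0 [c Cc x0E]] x0b.
pose S (s : R) := primal_feasible A b eps `&` [set s *: v | v in C].
pose D : set R := [set s | 0 <= s /\ S s !=set0].
have Dl : D l by split=> //; exists x0; split=> //; exists c.
have Smono s t : 0 <= s -> s <= t -> S s `<=` S t.
  move=> s0 st x [Fx sx]; have t0 := le_trans s0 st; split=> //.
  apply/(primal_cost_le bC C0 clC cvxC) => //.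
  move/(primal_cost_le bC C0 clC cvxC _ s0) : sx => /le_trans; apply.
  by rewrite lee_fin ler_pM2l ?invr_gt0// ler_sqr.
have [M M0 CM] := bounded_set_norm_le bC.
have [|||||x Sx] := @directed_closed_convex_meet _ _ _ D S (l * M).
- move=> s t Ds Dt; have [st|/ltW ts] := leP s t.
    by exists s => // u Su; split=> //; apply: Smono Su => //; exact: Ds.1.
  by exists t => // u Su; split=> //; apply: Smono Su => //; exact: Dt.1.
- by move=> s [].
- move=> s _; apply: closedI; last exact: closed_scaled.
  apply: (@closed_comp _ _ (fun x => `|A x - b|) [set r | r <= eps]); last exact: closed_le.
  by move=> u _; apply: cvg_norm; apply: cvgB; [exact: hA|exact: cvg_cst].
- move=> s _; apply/convex_setP => u v t [Fu su] [Fv sv] t01; split; last first.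
    by move/convex_setP: (@convex_scaled _ _ C cvxC s); exact.
  case/andP: t01 => t0 t1; have t1' : 0 <= 1 - t by rewrite subr_ge0.
  rewrite /primal_feasible/= linearD !linearZ/=.
  rewrite (_ : _ - b = t *: (A u - b) + (1 - t) *: (A v - b)); last first.
    by rewrite !scalerBr addrACA -opprD -scalerDl subrKC scale1r.
  rewrite (le_trans (ler_normD _ _))// !normrZ (ger0_norm t0) (ger0_norm t1').
  rewrite /primal_feasible/= in Fu Fv; nra.
- exists l => // _ [_ [v Cv <-]].
  by rewrite normrZ ger0_norm// ler_wpM2l// CM.
have [Fx [v Cv vx]] := Sx _ Dl.
exists x; split; last by exists l => //; exists v.
split=> //.
  have : (primal_cost C x <= (2^-1 * l ^+ 2)%:E)%E.
    by apply/(primal_cost_le bC C0 clC cvxC) => //; exists v.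
  have := gauge_fun_ge0 C x; rewrite /primal_cost.
  case: (gauge_fun C x) => [r||]//= _.
  by rewrite mulyy gt0_muley ?lte_fin ?invr_gt0.
move=> x' Fx'; have [fx'|] := boolP (primal_cost C x' \is a fin_num).
  have [s s0 sE] := primal_cost_sqr fx'.
  have Ss : S s x'.
    by split=> //; apply/(primal_cost_le bC C0 clC cvxC) => //; rewrite sE.
  have [_] : S s x by apply: Sx; split=> //; exists x'.
  by move/(primal_cost_le bC C0 clC cvxC _ s0); rewrite sE.
have := gauge_fun_ge0 C x'; rewrite {2}/primal_cost /primal_cost.
case: (gauge_fun C x') => [r||]//= _ _.
by rewrite mulyy gt0_muley ?lte_fin ?invr_gt0// leey.
Qed.

(** Replacing [b] by a point [A (l *: v)] at distance at most [dl] costs at most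
    [dl * `|y|] in the pairing with [y]. *)
Lemma closure_image_bound dl : 0 < dl -> closure (A @` cone C) b ->
  exists lam, forall y, ⟨b, y⟩ <= lam * support_fun (A @` C) y + dl * `|y|.
Proof.
move=> dl0 /closure_normP /(_ _ dl0)[_ [_ [l l0 [v Cv ->]] <-] bv].
exists l => y; rewrite -[b](subrK (A (l *: v))) innerDl addrC lerD//.
  rewrite linearZ/= innerZl ler_wpM2l// innerC.
  by apply: le_support_fun; [exact: bounded_image|exists v].
by rewrite (le_trans (cauchy_schwarz _ _))// ler_wpM2r.
Qed.

Lemma dual_solution_exists_unique eps : 0 < eps -> closure (A @` cone C) b ->
  exists! y, dual_solution A b C eps y.
Proof.
move=> eps0 clb; have dl0 : 0 < eps / 2 by rewrite divr_gt0.
have dle : eps / 2 < eps by lra.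
have [lam bl] := closure_image_bound dl0 clb.
have [y ymin] := support_objective_minimum bounded_image image0 (ltW dl0) dle bl.
exists y; split; first by apply/dual_solutionP.
move=> z /dual_solutionP zmin.
exact: (support_objective_minimum_unique bounded_image image0 (ltW dl0) dle bl).
Qed.

(** Projection of [b] on the image of the dilation of [C] by [s]. *)
Lemma image_scaled_nearest s : 0 <= s ->
  exists2 x, C x & forall v, C v -> ⟨b - A (s *: x), A (s *: v) - A (s *: x)⟩ <= 0.
Proof.
move=> s0; pose g x := `|A (s *: x) - b|.
have [||||||x Cx xmin] := @convex_minimum_attained _ _ C g.
- by exists 0.
- by [].
- by [].
- move=> u; apply: cvg_norm; apply: cvgB; last exact: cvg_cst.
  apply: (@continuous_comp _ _ _ (fun x : X => s *: x) A); last exact: hA.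
  exact: scaler_continuous.
- move=> u v t /andP[t0 t1]; have t1' : 0 <= 1 - t by rewrite subr_ge0.
  rewrite /g (_ : _ - b = t *: (A (s *: u) - b) + (1 - t) *: (A (s *: v) - b)).
    by rewrite (le_trans (ler_normD _ _))// !normrZ (ger0_norm t0) (ger0_norm t1').
  rewrite !scalerBr addrACA -opprD -scalerDl subrKC scale1r.
  by rewrite !linearZ/= linearD !linearZ/= scalerDr !scalerA (mulrC s) (mulrC s).
- by move=> t; have [M _ CM] := bounded_set_norm_le bC; exists M => u /CM.
exists x => // v Cv; rewrite -oppr_ge0.
rewrite -(pmulr_rge0 _ (ltr0n R 2)).
apply: (@quadratic_slope_ge0 _ (`|A (s *: v) - A (s *: x)| ^+ 2)) => t /andP[t0 t1].
have := xmin _ ((convex_setP C).1 cvxC v x t Cv Cx _); rewrite (ltW t0) t1 => /(_ isT).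
rewrite /g (_ : A (s *: (_ + _)) - b =
  - ((b - A (s *: x)) - t *: (A (s *: v) - A (s *: x)))); last first.
  have -> : A (s *: (t *: v + (1 - t) *: x)) = t *: A (s *: v) + (1 - t) *: A (s *: x).
    by rewrite !linearZ/= linearD !linearZ/= scalerDr !scalerA (mulrC s) (mulrC s).
  rewrite scalerBl scale1r scalerBr !opprB [in RHS]addrA; congr (_ - b).
  by rewrite addrA addrAC.
rewrite normrN distrC -ler_sqr ?nnegrE// (sqr_normB (b - _)) innerZr normrZ exprMn.
rewrite (gtr0_norm t0); lra.
Qed.

(** The main step. Let [s] be the value of the support function at the dual
    solution. If the dilation of [C] by [s] contained no feasible point, let [w]
    be [b] minus its projection on the image of this dilation. By the obtuse
    angle property the slope of the dual objective in the direction [w] is at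
    most [eps * `|w| - `|w| ^+ 2 < 0], which is absurd at a minimizer. *)
Lemma strong_duality eps y : 0 <= eps -> dual_solution A b C eps y ->
  exists2 x, primal_feasible A b eps x &
    [set support_fun C (adjoint A y) *: v | v in C] x.
Proof.
move=> eps0 /dual_solutionP ymin; rewrite support_fun_adjoint.
set s := support_fun _ y.
have sge0 : 0 <= s := support_fun_ge0 bounded_image image0 y.
have [x Cx xP] := image_scaled_nearest sge0.
exists (s *: x); last by exists x.
set w := b - A (s *: x).
have : s * support_fun (A @` C) w <= ⟨w, A (s *: x)⟩.
  have [->|sn0] := eqVneq s 0; first by rewrite mul0r scale0r linear0 inner0r.
  have sgt0 : 0 < s by rewrite lt_neqAle eq_sym sn0.
  rewrite mulrC -ler_pdivlMr//; apply: support_fun_le; first exact: image0.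
  move=> _ [v Cv <-]; rewrite ler_pdivlMr// mulrC -innerZr -linearZ/= -subr_le0 -innerBr.
  exact: xP.
have := support_objective_min_slope bounded_image image0 w ymin eps0.
rewrite -/s => h2 h1.
have : ⟨b, w⟩ = ⟨w, A (s *: x)⟩ + `|w| ^+ 2.
  by rewrite -innerxx (innerC b) -innerDr (addrC (A _)) subrK.
move=> bw; rewrite /primal_feasible/= distrC -/w.
have := normr_ge0 w; rewrite le_eqVlt => /predU1P[<-//|w0].
by rewrite -(ler_pM2l w0) -expr2 mulrC; lra.
Qed.

(** By strong duality a primal solution is [s *: v] with [v] in [C]. Feasibility
    and the Euler inequality for [y] give [s ^+ 2 <= s * ⟨adjoint A y, v⟩], so
    that [v] attains the support function when [s] is positive; when [s = 0] the
    vector [0] attains it. *)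
Lemma primal_dual_optimality eps x y : 0 <= eps ->
  primal_solution A b C eps x -> dual_solution A b C eps y ->
  exists2 v, subdiff_support C (adjoint A y) v & x = support_fun C (adjoint A y) *: v.
Proof.
move=> eps0 [Fx _ xmin] ysol; have [x0 Fx0 sx0] := strong_duality eps0 ysol.
set s := support_fun C (adjoint A y).
have sge0 : 0 <= s := support_fun_ge0 bC C0 _.
have [v Cv vx] : [set s *: v | v in C] x.
  apply/(primal_cost_le bC C0 clC cvxC) => //; apply: le_trans (xmin _ Fx0) _.
  exact/(primal_cost_le bC C0 clC cvxC).
have [s0|sn0] := eqVneq s 0.
  by exists 0; [split=> //; rewrite inner0r -/s s0|rewrite -vx s0 !scale0r].
exists v => //; split=> //; apply/eqP; rewrite eq_le le_support_fun//=.
have sgt0 : 0 < s by rewrite lt_neqAle eq_sym sn0.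
rewrite -(ler_pM2l sgt0) -/s -innerZr vx innerC.
have -> : ⟨x, adjoint A y⟩ = ⟨A x, y⟩ by rewrite adjointP// innerC.
have := support_objective_min_euler bounded_image image0 ((dual_solutionP _ _).1 ysol).
rewrite -support_fun_adjoint -/s -expr2 => /le_trans; apply.
rewrite lerBlDl -lerBlDr -innerBl (le_trans (cauchy_schwarz _ _))// ler_wpM2r//.
by rewrite distrC.
Qed.

(** A singleton exposed face is an extreme point: a segment of [C] through [v] in
    its interior stays in the face. *)
Lemma subdiff_singleton_ext z v : subdiff_support C z = [set v] -> ext C v.
Proof.
move=> zv; have [Cv vz] : subdiff_support C z v by rewrite zv.
split=> // x y t Cx Cy /andP[t0 t1] vE.
have xz := le_support_fun bC z Cx; have yz := le_support_fun bC z Cy.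
have E : support_fun C z = t * ⟨z, x⟩ + (1 - t) * ⟨z, y⟩.
  by rewrite -vz vE innerDr !innerZr.
have sub u : C u -> support_fun C z <= ⟨z, u⟩ -> u = v.
  move=> Cu h; have : subdiff_support C z u.
    by split=> //; apply/eqP; rewrite eq_le h le_support_fun.
  by rewrite zv.
by split; apply: sub => //; nra.
Qed.

(** Under [hyp_H] either the face exposed by [adjoint A y] is a singleton, whose
    point is extreme, hence in [K]; or the support function vanishes there and
    the primal solution is [0]. *)
Lemma exact_recovery (K : set X) eps x y : 0 <= eps -> K 0 ->
  hyp_H A C -> hyp_E K C ->
  primal_solution A b C eps x -> dual_solution A b C eps y ->
  cone K x /\ [set x] = [set support_fun C (adjoint A y) *: v
                        | v in subdiff_support C (adjoint A y)].
Proof.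
move=> eps0 K0 H E xsol ysol.
have [v vsub ->] := primal_dual_optimality eps0 xsol ysol.
set s := support_fun C (adjoint A y).
have sge0 : 0 <= s := support_fun_ge0 bC C0 _.
case: (H y) => [|pol].
  move=> /contrapT[u uE]; have vu : v = u by rewrite uE in vsub.
  split; last by rewrite uE image_set1 vu.
  exists s => //; exists v => //; apply: E; rewrite vu; exact: subdiff_singleton_ext uE.
have s0 : s = 0.
  apply/eqP; rewrite eq_le sge0 andbT; apply: support_fun_le => // u Cu.
  by apply: pol; exists 1 => //; exists u => //; rewrite scale1r.
split; first by exists 0 => //; exists 0 => //; rewrite s0 !scale0r.
apply/seteqP; split=> [_ ->|_ [u usub <-]]; first by exists v.
by rewrite /= s0 !scale0r.
Qed.

End PrimalDual.

Theorem theorem1p6 (R : realType) (X Y : hilbertType R)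
    (A : {linear X -> Y}) (hA : continuous A) (b : Y)
    (P K : set X) (hP : is_cone P) (hKb : bounded_set K) (hK0 : K 0)
    (hKP : cone K = P) :
  let Kr := closed_conv K in
  let Pr := cone Kr in
  (closure (A @` Pr) b ->
    forall eps : R, 0 < eps ->
    [/\ exists x, [/\ primal_solution A b Kr eps x, Pr x & `|A x - b| <= eps],
        exists! y, dual_solution A b Kr eps y
      & hyp_H A Kr -> hyp_E K Kr ->
        forall x y, primal_solution A b Kr eps x -> dual_solution A b Kr eps y ->
        [/\ forall x', primal_solution A b Kr eps x' -> x' = x,
            P x
          & [set x] = [set support_fun Kr (adjoint A y) *: v
                      | v in subdiff_support Kr (adjoint A y)]]])
  /\
  ((A @` Pr) b ->
    (exists x, [/\ primal_solution A b Kr 0 x, Pr x & A x = b])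
    /\
    (forall x y, primal_solution A b Kr 0 x -> dual_solution A b Kr 0 y ->
       hyp_H A Kr -> hyp_E K Kr ->
       P x /\
       [set x] = [set support_fun Kr (adjoint A y) *: v
                 | v in subdiff_support Kr (adjoint A y)])).
Proof.
move=> Kr Pr.
have bKr : bounded_set Kr := bounded_closed_conv hKb.
have Kr0 : Kr 0 := sub_closed_conv hK0.
have clKr : closed Kr := @closed_closed_conv _ _ _.
have cvxKr : @convex_set R X Kr := @convex_closed_conv _ _ _.
rewrite -hKP.
split=> [clb eps eps0|[x0 Prx0 x0b]]; split.
- have [_ [[x0 Prx0 <-] bx0]] : exists y, (A @` Pr) y /\ `|b - y| <= eps.
    by have [c ? ?] := (closure_normP _ _).1 clb _ eps0; exists c.
  have [|x [xsol Px]] :=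
    @primal_solution_exists _ _ _ A b Kr hA bKr Kr0 clKr cvxKr eps x0 Prx0.
    by rewrite distrC.
  by exists x; split=> //; case: xsol.
- exact: dual_solution_exists_unique.
- move=> H E x y xsol ysol.
  have rec u usol :=
    @exact_recovery _ _ _ A b Kr hA bKr Kr0 clKr cvxKr K eps u y (ltW eps0) hK0 H E usol ysol.
  have [Px xE] := rec _ xsol; split=> // x' /rec[_].
  by rewrite -xE => /seteqP[/(_ x' erefl)].
- have [|x [xsol Px]] :=
    @primal_solution_exists _ _ _ A b Kr hA bKr Kr0 clKr cvxKr 0 x0 Prx0.
    by rewrite x0b subrr normr0.
  exists x; split=> //; case: xsol => Fx _ _.
  by apply/eqP; rewrite -subr_eq0 -normr_le0.
- move=> x y xsol ysol H E.
  exact: (exact_recovery hA bKr Kr0 clKr cvxKr _ hK0 H E xsol ysol).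
Qed.
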